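(* There exist continua $X$ with the property that shadowing is not dense in $\mathcal{C}(X)$, i.e. the set of $f\in\mathcal{C}(X)$ such that $(X,f)$ has shadowing is not a dense subset of $\mathcal{C}(X)$. In particular, for each $n\in\mathbb{N}$, shadowing is not dense in $\mathcal{C}(H_n)$, where $H_n$ is Cook's continuum.
   Context: A continuum is a compact connected metric space; $\mathbb{N}$ is the set of positive integers and $\omega$ the non-negative integers. For a compact metric space $(X,d)$, $\mathcal{C}(X)$ is the space of continuous maps $f:X\to X$ with the supremum metric $\rho(f,g)=\sup_{x\in X}d(f(x),g(x))$, and $\mathcal{S}(X)\subseteq\mathcal{C}(X)$ is the subspace of surjections. For $\delta>0$, a $\delta$-pseudo-orbit for $f\in\mathcal{C}(X)$ is a sequence $\langle x_i\rangle_{i\in\omega}$ in $X$ with $d(f(x_i),x_{i+1})<\delta$ for all $i\in\omega$. $(X,f)$ has shadowing if for every $\epsilon>0$ there is $\delta>0$ such that for every $\delta$-pseudo-orbit $\langle x_i\rangle$ for $f$ there is $z\in X$ with $d(x_i,f^i(z))<\epsilon$ for all $i\in\omega$. Cook's continua (a known result of Cook, which may be assumed): for each $n\in\mathbb{N}$ there exists a non-degenerate continuum $H_n$ (i.e. with more than one point) such that $\mathcal{S}(H_n)$ has exactly $n$ elements, each of which is a homeomorphism, and every $f\in\mathcal{C}(H_n)\setminus\mathcal{S}(H_n)$ is constant (i.e. $f(H_n)$ is a singleton). $H_n$ denotes such a continuum. *)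

(* Defs.v *)
From HB Require Import structures.
From mathcomp Require Import all_boot all_order all_algebra.
From mathcomp Require Import all_classical all_reals all_analysis.

Set Implicit Arguments.
Unset Strict Implicit.
Unset Printing Implicit Defensive.

Import Order.TTheory GRing.Theory Num.Theory.
Import numFieldNormedType.Exports.

Local Open Scope classical_set_scope.
Local Open Scope ring_scope.

HB.mixin Record Metric_isCompact (R : realType) T & Metric R T := {
  compact_space : compact [set: T]
}.

#[short(type="compactMetricType")]
HB.structure Definition CompactMetric (R : realType) :=
  { T of Metric R T & Metric_isCompact R T }.

HB.mixin Record Metric_isConnected (R : realType) T & Metric R T := {
  connected_space : connected [set: T]
}.

#[short(type="continuumType")]
HB.structure Definition Continuum (R : realType) :=
  { T of CompactMetric R T & Metric_isConnected R T }.

(* An alias of [continuousType X X] that carries the supremum metric, and hence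
   the topology of that metric, instead of the topologies which the library
   attaches to [continuousType]. *)
Definition selfmap (R : realType) (X : compactMetricType R) : Type :=
  continuousType X X.

Section supremum_metric.
Context {R : realType} {X : compactMetricType R}.
Implicit Types f g h : selfmap X.

Definition supdist f g : R := sup [set mdist (f x) (g x) | x in [set: X]].

Lemma mdist_bounded : exists M : R, forall x y : X, mdist x y <= M.
Proof.
have [[a _]|/set0P/negP/negPn/eqP X0] := pselect ([set: X] !=set0); last first.
  by exists 0 => x; have : [set: X] x by []; rewrite X0.
have /compact_near_coveringP/(_ nat \oo (fun n x => mdist a x < n%:R)) :=
  @compact_space R X.
case=> [x _|N _ /(_ N (leqnn N)) aN].
  exists (ball x 1, [set n | mdist a x + 1 <= n%:R]) => [|[y n] []/=].
    by split; [exact: nbhsx_ballx | exact: nbhs_infty_ger].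
  rewrite ballEmdist/= => xy an; apply: lt_le_trans an.
  by rewrite (le_lt_trans (metric_triangle _ x _))// ltrD2l.
exists (N%:R + N%:R) => x y; rewrite (le_trans (metric_triangle _ a _))//.
by rewrite lerD// ltW ?aN// metric_sym aN.
Qed.

Lemma supdist_ge f g x : mdist (f x) (g x) <= supdist f g.
Proof.
apply: ub_le_sup; last by exists x.
by have [M XM] := mdist_bounded; exists M => _ [y _ <-].
Qed.

Lemma supdist_le f g (e : R) :
  0 <= e -> (forall x, mdist (f x) (g x) <= e) -> supdist f g <= e.
Proof.
move=> e0 fg; rewrite /supdist; set A := [set _ | _ in _].
have [A0|/set0P/negP/negPn/eqP->] := pselect (A !=set0); last by rewrite sup0.
by apply: ge_sup => // _ [x _ <-].
Qed.

Lemma supdist_ge0 f g : 0 <= supdist f g.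
Proof.
rewrite /supdist; set A := [set _ | _ in _].
have [[_ [x _ _]]|/set0P/negP/negPn/eqP->] := pselect (A !=set0).
  exact: le_trans (mdist_ge0 _ _) (supdist_ge f g x).
by rewrite sup0.
Qed.

Lemma supdistxx f : supdist f f = 0.
Proof.
apply/eqP; rewrite eq_le supdist_ge0 andbT.
by apply: supdist_le => // x; rewrite mdistxx.
Qed.

Lemma supdist_positivity f g : supdist f g = 0 -> f = g.
Proof.
move=> fg; apply/continuousEP => x; apply: (@mdist_positivity R); apply/eqP.
by rewrite eq_le mdist_ge0 andbT -fg supdist_ge.
Qed.

Lemma supdist_sym f g : supdist f g = supdist g f.
Proof.
by congr (sup _); apply: eq_imagel => x _; rewrite metric_sym.
Qed.

Lemma supdist_triangle g f h : supdist f h <= supdist f g + supdist g h.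
Proof.
apply: supdist_le => [|x]; first by rewrite addr_ge0// supdist_ge0.
by rewrite (le_trans (metric_triangle _ (g x) _))// lerD// supdist_ge.
Qed.

HB.instance Definition _ := Choice.copy (selfmap X) (continuousType X X).

HB.instance Definition _ := @isMetric.Build R (selfmap X) supdist
  supdistxx supdist_positivity supdist_sym supdist_triangle.

Lemma selfmap_mdistE f g :
  mdist f g = sup [set mdist (f x) (g x) | x in [set: X]].
Proof. by []. Qed.

End supremum_metric.

Section shadowing.
Context {R : realType} {X : compactMetricType R}.
Implicit Types (f : selfmap X) (x : nat -> X).

Definition pseudo_orbit (delta : R) f x :=
  forall i, mdist (f (x i)) (x i.+1) < delta.

Definition shadowing f :=
  forall eps : R, 0 < eps -> exists2 delta : R, 0 < delta &
    forall x, pseudo_orbit delta f x ->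
      exists z : X, forall i, mdist (x i) (iter i f z) < eps.

End shadowing.

Definition shadowing_dense (R : realType) (X : compactMetricType R) :=
  dense [set f : selfmap X | shadowing f].

Definition surjections (R : realType) (X : compactMetricType R) :
    set (selfmap X) :=
  [set f | set_surj [set: X] [set: X] f].

Arguments surjections {R} X f.

Definition homeomorphism (T U : topologicalType) (f : T -> U) :=
  continuous f /\
  exists g : U -> T, [/\ continuous g, cancel f g & cancel g f].

Definition cook_continuum (R : realType) (n : nat) (H : continuumType R) :=
  [/\ exists x y : H, x <> y,
      (surjections H #= `I_n)%card,
      forall f, surjections H f -> homeomorphism f &
      forall f, ~ surjections H f -> exists c : H, range f = [set c]].

(* Main.v *)
Require Import Defs.
From HB Require Import structures.
From mathcomp Require Import all_boot all_order all_algebra.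
From mathcomp Require Import all_classical all_reals all_analysis.

(** The identity of a Cook continuum [H] is an isolated point of the space of
    self-maps of [H], so a dense set of maps must contain it, but the identity
    of a non-degenerate continuum does not have shadowing.

    Isolation ([open_set1_idfun]): a map close to the identity is not constant,
    because a constant map cannot move two distinct points of [H] by less than
    half of their distance ([dist_range1]); hence it is a surjection, and there
    are only finitely many of these, so those other than the identity form a
    closed set.

    Failure of shadowing ([shadowing_idfun]): the pseudo-orbits of the identity
    are the sequences with small steps, and connectedness yields such a sequence
    from any point to any other ([idfun_pseudo_orbit]).  The orbits of the
    identity are constant, so they follow no sequence that goes far away from
    its starting point. *)

Import Order.TTheory GRing.Theory Num.Theory.
Local Open Scope classical_set_scope.
Local Open Scope ring_scope.

(** The set of points that can be reached from [a] is open and closed for the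
    same reason: a point at distance less than [delta] from a reachable point is
    reachable by one more step. *)
Lemma idfun_pseudo_orbit (R : realType) (X : continuumType R) (delta : R)
    (a b : X) : 0 < delta ->
  exists x : nat -> X,
    [/\ pseudo_orbit delta (idfun : selfmap X) x, x 0%N = a &
        exists n, x n = b].
Proof.
move=> d0.
pose B : set X := [set c | exists x : nat -> X,
  [/\ pseudo_orbit delta (idfun : selfmap X) x, x 0%N = a &
      exists n, x n = c]].
suff BT : B = [set: X] by have : [set: X] b by []; rewrite -BT.
have B_step c c' : B c -> mdist c c' < delta -> B c'.
  move=> [x [px x0 [n xn]]] cc'.
  (* Follow the chain up to [c], step to [c'] and stay there. *)
  exists (fun i => if (i <= n)%N then x i else c'); split => //.
    move=> i /=; have [lt_in|le_ni] := ltnP i n.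
      by rewrite (ltnW lt_in); exact: px.
    case: ifP => [le_in|_]; last by rewrite mdistxx.
    by have -> : i = n; [apply/eqP; rewrite eqn_leq le_in | rewrite xn].
  by exists n.+1; rewrite ltnn.
apply: (@connected_space R X).
- by exists a, (fun=> a); split => //; [move=> i; rewrite mdistxx | exists 0%N].
- exists B; last by rewrite setTI.
  rewrite openE => c Bc; apply/nbhs_ballP; exists delta => //= c'.
  by rewrite ballEmdist; exact: B_step.
- exists B; last by rewrite setTI.
  move=> c /(_ (ball c delta) (nbhsx_ballx _ _ d0)) [c' [Bc']].
  by rewrite ballEmdist/= metric_sym; exact: B_step.
Qed.

(** Every orbit of the identity is constant, so a point that shadows a chain from
    [a] to [b] is close to both of its ends. *)
Lemma shadowing_idfun (R : realType) (X : continuumType R) :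
  shadowing (idfun : selfmap X) -> forall a b : X, a = b.
Proof.
move=> sh a b; apply/eqP/negPn/negP; rewrite -mdist_gt0 => ab.
have [delta d0 {}sh] := sh _ (divr_gt0 ab (ltr0n _ 2)).
have [x [px x0 [n xn]]] := idfun_pseudo_orbit R X delta a b d0.
have [z zx] := sh x px.
have iterz i : iter i (idfun : selfmap X) z = z by elim: i.
have := zx 0%N; have := zx n; rewrite !iterz x0 xn => bz az.
have := le_lt_trans (metric_triangle a z b) (ltrD az _).
by rewrite (metric_sym z b) => /(_ _ bz); rewrite -splitr ltxx.
Qed.

(** The bound is half of [mdist a b] because both [a] and [b] are moved to [c],
    so the two displacements add up to at least [mdist a b]. *)
Lemma dist_range1 (R : realType) (X : compactMetricType R) (f : selfmap X)
    (c a b : X) :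
  range f = [set c] -> mdist a b / 2 <= mdist (idfun : selfmap X) f.
Proof.
move=> fc; have fE x : f x = c.
  have : range f (f x) by exists x.
  by rewrite fc.
rewrite ler_pdivrMr// mulr_natr mulr2n.
apply: le_trans (metric_triangle a c b) _; apply: lerD.
  by rewrite -(fE a); exact: (supdist_ge (idfun : selfmap X)).
by rewrite metric_sym -(fE b); exact: (supdist_ge (idfun : selfmap X)).
Qed.

(** Away from the identity, the finite set of surjections is closed and the
    constant maps are bounded away by [dist_range1], so both can be avoided by
    one neighborhood. *)
Lemma open_set1_idfun (R : realType) (X : compactMetricType R) :
  (exists a b : X, a <> b) -> finite_set (surjections X) ->
  (forall f : selfmap X, ~ surjections X f -> exists c, range f = [set c]) ->
  open [set (idfun : selfmap X)].
Proof.
move=> [a [b /eqP]]; rewrite -mdist_gt0 => ab finS constS.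
set e := mdist a b / 2; have e0 : 0 < e by rewrite divr_gt0.
pose S' := surjections X `\ (idfun : selfmap X).
have clS' : closed S'.
  apply: (accessible_finite_set_closed.1 _ _ (finite_setD _ finS)).
  exact/hausdorff_accessible/metric_hausdorff.
rewrite openE => _ ->.
have nS' : nbhs (idfun : selfmap X) (~` S').
  by apply: open_nbhs_nbhs; split; [exact: closed_openC | case=> _; exact].
have nB := nbhsx_ballx (idfun : selfmap X) _ e0.
apply: filterS (filterI nS' nB) => f [nS'f]; rewrite ballEmdist/= => idf.
apply: contrapT => f_id; apply: nS'f; split => //.
apply: contrapT => /constS[c fc].
by have := dist_range1 R X f c a b fc; rewrite leNgt idf.
Qed.

Lemma dense_isolated {T : topologicalType} (A : set T) (x : T) :
  dense A -> open [set x] -> A x.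
Proof. by move=> dA /(dA _ (ex_intro _ x erefl)) [_ [-> ]]. Qed.

Lemma cook_continuum_not_shadowing_dense (R : realType) (n : nat)
    (H : continuumType R) : cook_continuum n H -> ~ shadowing_dense H.
Proof.
move=> [nondeg cardS _ constS] dH; have [a [b]] := nondeg; apply.
apply: shadowing_idfun; apply: (dense_isolated _ _ dH).
by apply: open_set1_idfun => //; exists n.
Qed.

Theorem theorem15 (R : realType) :
  ((forall n : nat, (0 < n)%N ->
      exists H : continuumType R, cook_continuum n H) ->
    exists X : continuumType R, ~ shadowing_dense X) /\
  (forall (n : nat) (H : continuumType R),
    (0 < n)%N -> cook_continuum n H -> ~ shadowing_dense H).
Proof.
split=> [/(_ 1%N isT)[H cookH]|n H _].
  by exists H; exact: (cook_continuum_not_shadowing_dense _ 1).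
exact: cook_continuum_not_shadowing_dense.
Qed.
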